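(* Let $(S,\theta)$ be an ID-simple ring and let $(M,\theta_M)$ be an ID-module over $(S,\theta)$. Then every ID-stable $S$-submodule of $M$ is a finitely generated $S$-module, and hence an ID-submodule of $M$.
   Context: All rings are commutative with unit and nonzero; rings are not assumed Noetherian. An iterative derivation on a ring $R$ is a ring homomorphism $\theta:R\to R[[T]]$, written $\theta(r)=\sum_{i\ge 0}\theta^{(i)}(r)T^i$, with $\theta^{(0)}=\mathrm{id}_R$ and $\theta^{(i)}\circ\theta^{(j)}=\binom{i+j}{i}\theta^{(i+j)}$ for all $i,j\ge 0$; then $(R,\theta)$ is an ID-ring. An ideal $I$ of $R$ is an ID-ideal if $\theta(I)\subseteq I[[T]]$; $R$ is ID-simple if its only ID-ideals are $\{0\}$ and $R$. An ID-module $(M,\theta_M)$ over an ID-ring $(R,\theta)$ is a finitely generated $R$-module $M$ with an additive map $\theta_M:M\to M[[T]]$, $\theta_M(m)=\sum_i\theta_M^{(i)}(m)T^i$, such that $\theta_M(rm)=\theta(r)\theta_M(m)$ for $r\in R$, $m\in M$, $\theta_M^{(0)}=\mathrm{id}_M$ and $\theta_M^{(i)}\circ\theta_M^{(j)}=\binom{i+j}{i}\theta_M^{(i+j)}$ for all $i,j\ge0$. A subset $N\subseteq M$ is ID-stable if $\theta_M^{(n)}(N)\subseteq N$ for all $n\ge 0$. An ID-submodule of $M$ is an ID-stable $R$-submodule which is finitely generated as an $R$-module. *)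

(* Defs.v *)
From HB Require Import structures.
From mathcomp Require Import all_boot all_order all_algebra.
From mathcomp Require Import boolp classical_sets.

Set Implicit Arguments.
Unset Strict Implicit.
Unset Printing Implicit Defensive.

Import GRing.Theory.
Local Open Scope ring_scope.
Local Open Scope classical_set_scope.

(* [{fps A}] is A[[T]]: a series f is its sequence of coefficients, so [f i]
   is the coefficient of T^i. Its algebraic structure is not the pointwise one
   of functions: products and scalings are Cauchy products. *)
Definition fps (A : Type) := nat -> A.
Notation "{ 'fps' A }" := (fps A) (format "{ 'fps'  A }") : type_scope.

HB.instance Definition _ (A : Type) := gen_eqMixin {fps A}.
HB.instance Definition _ (A : Type) := gen_choiceMixin {fps A}.

Lemma fpsP (A : Type) (f g : {fps A}) : (forall i, f i = g i) <-> f = g.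
Proof. by split=> [/funext|->]. Qed.

Section FpsZmodule.
Variable V : zmodType.
Implicit Types f g h : {fps V}.

Definition fps_zero : {fps V} := fun=> 0.
Definition fps_opp f : {fps V} := fun n => - f n.
Definition fps_add f g : {fps V} := fun n => f n + g n.

Fact fps_addA : associative fps_add.
Proof. by move=> f g h; apply/fpsP => n; exact: addrA. Qed.
Fact fps_addC : commutative fps_add.
Proof. by move=> f g; apply/fpsP => n; exact: addrC. Qed.
Fact fps_add0 : left_id fps_zero fps_add.
Proof. by move=> f; apply/fpsP => n; exact: add0r. Qed.
Fact fps_addN : left_inverse fps_zero fps_opp fps_add.
Proof. by move=> f; apply/fpsP => n; exact: addNr. Qed.

HB.instance Definition _ :=
  GRing.isZmodule.Build {fps V} fps_addA fps_addC fps_add0 fps_addN.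

Lemma fps0E n : (0 : {fps V}) n = 0. Proof. by []. Qed.
Lemma fpsDE f g n : (f + g) n = f n + g n. Proof. by []. Qed.
Lemma fpsNE f n : (- f) n = - f n. Proof. by []. Qed.
End FpsZmodule.

Lemma fps_triangular_sum (V : nmodType) (F : nat -> nat -> nat -> V) n :
  \sum_(i < n.+1) \sum_(j < (n - i).+1) F i j (n - i - j)%N =
  \sum_(k < n.+1) \sum_(i < k.+1) F i (k - i)%N (n - k)%N.
Proof.
transitivity (\sum_(i < n.+1) \sum_(k < n.+1 | (i <= k)%N)
                 F i (k - i)%N (n - k)%N).
  apply: eq_bigr => i _.
  rewrite -(big_mkord (fun k => (i <= k)%N)
              (fun k => F i (k - i)%N (n - k)%N)).
  rewrite (big_cat_nat (n := i)) //=; last by rewrite ltnW.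
  rewrite [X in _ = X + _]big_nat_cond [X in _ = X + _]big1 ?add0r; last first.
    by move=> k /andP[/andP[_ ki] ik]; rewrite ltnNge ik in ki.
  rewrite -[X in \sum_(X <= _ < _ | _) _]add0n big_addn subSn -1?ltnS //.
  rewrite big_mkord; apply: eq_big => [j|j _]; first by rewrite leq_addl.
  by rewrite addnK subnDA subnAC.
rewrite (exchange_big_dep predT) //=; apply: eq_bigr => k _.
rewrite -(big_mkord (fun i => (i <= k)%N)
              (fun i => F i (k - i)%N (n - k)%N)).
rewrite (big_cat_nat (n := k.+1)) //=.
rewrite [X in _ + X]big_nat_cond [X in _ + X]big1 ?addr0; last first.
  by move=> i /andP[/andP[ki _] ik]; rewrite ltnNge ik in ki.
rewrite big_mkord; apply: eq_bigl => i.
by rewrite -ltnS ltn_ord.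
Qed.

Section FpsScale.
Variables (R : pzRingType) (M : lmodType R).

Definition fps_scale (f : {fps R}) (m : {fps M}) : {fps M} :=
  fun n => \sum_(i < n.+1) f i *: m (n - i)%N.
End FpsScale.

Section FpsRing.
Variable R : comNzRingType.
Implicit Types f g h : {fps R}.

Definition fps_one : {fps R} := fun n => (n == 0)%:R.
Definition fps_mul f g : {fps R} := fun n => \sum_(i < n.+1) f i * g (n - i)%N.

Fact fps_mulC : commutative fps_mul.
Proof.
move=> f g; apply/fpsP => n; rewrite /fps_mul.
rewrite (reindex_inj rev_ord_inj) /=; apply: eq_bigr => i _.
by rewrite subSS subKn ?leq_ord // mulrC.
Qed.

Fact fps_mulA : associative fps_mul.
Proof.
move=> f g h; apply/fpsP => n; rewrite /fps_mul.
under eq_bigr do rewrite mulr_sumr.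
rewrite (fps_triangular_sum (fun i j k => f i * (g j * h k))).
by apply: eq_bigr => k _; rewrite mulr_suml; under eq_bigr do rewrite mulrA.
Qed.

Fact fps_mul1 : left_id fps_one fps_mul.
Proof.
move=> f; apply/fpsP => n; rewrite /fps_mul big_ord_recl mul1r subn0.
by rewrite big1 ?addr0 // => i _; rewrite mul0r.
Qed.

Fact fps_mulDl : left_distributive fps_mul +%R.
Proof.
move=> f g h; apply/fpsP => n; rewrite fpsDE /fps_mul -big_split.
by apply: eq_bigr => i _; rewrite fpsDE mulrDl.
Qed.

Fact fps_one_neq0 : fps_one != 0.
Proof. by apply/eqP => /(congr1 (@^~ 0)) /eqP; rewrite oner_eq0. Qed.

HB.instance Definition _ := GRing.Zmodule_isComNzRing.Build {fps R}
  fps_mulA fps_mulC fps_mul1 fps_mulDl fps_one_neq0.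

Lemma fps1E n : (1 : {fps R}) n = (n == 0)%:R. Proof. by []. Qed.
Lemma fpsME f g n : (f * g) n = \sum_(i < n.+1) f i * g (n - i)%N.
Proof. by []. Qed.
End FpsRing.

Section FpsLmodule.
Variables (R : comNzRingType) (M : lmodType R).
Implicit Types (f g : {fps R}) (m : {fps M}).

Fact fps_scaleA f g m : fps_scale f (fps_scale g m) = fps_scale (f * g) m.
Proof.
apply/fpsP => n; rewrite /fps_scale.
under eq_bigr do rewrite scaler_sumr.
rewrite (fps_triangular_sum (fun i j k => f i *: (g j *: m k))).
apply: eq_bigr => k _; rewrite fpsME scaler_suml.
by under eq_bigr do rewrite scalerA.
Qed.

Fact fps_scale1 : left_id 1 (@fps_scale R M).
Proof.
move=> m; apply/fpsP => n; rewrite /fps_scale big_ord_recl scale1r subn0.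
by rewrite big1 ?addr0 // => i _; rewrite scale0r.
Qed.

Fact fps_scaleDr : right_distributive (@fps_scale R M) +%R.
Proof.
move=> f m1 m2; apply/fpsP => n; rewrite fpsDE /fps_scale -big_split.
by apply: eq_bigr => i _; rewrite fpsDE scalerDr.
Qed.

Fact fps_scaleDl m : {morph (@fps_scale R M)^~ m : f g / f + g}.
Proof.
move=> f g; apply/fpsP => n; rewrite fpsDE /fps_scale -big_split.
by apply: eq_bigr => i _; rewrite fpsDE scalerDl.
Qed.

HB.instance Definition _ := GRing.Zmodule_isLmodule.Build {fps R} {fps M}
  fps_scaleA fps_scale1 fps_scaleDr fps_scaleDl.

Lemma fpsZE f m n : (f *: m) n = \sum_(i < n.+1) f i *: m (n - i)%N.
Proof. by []. Qed.
End FpsLmodule.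

Definition is_submodule (R : pzRingType) (M : lmodType R) (N : set M) : Prop :=
  submod_closed [in N].

Definition is_ideal (R : comNzRingType) (I : set R) : Prop :=
  is_submodule (I : set R^o).

Definition finitely_generated (R : pzRingType) (M : lmodType R) (N : set M) :
    Prop :=
  exists (n : nat) (g : 'I_n -> M),
    N = [set m | exists c : 'I_n -> R, m = \sum_i c i *: g i].

(* I[[T]] as a subset of A[[T]] *)
Definition fps_set (A : Type) (I : set A) : set {fps A} :=
  [set f | forall i, I (f i)].

(* theta^(0) = id and theta^(i) \o theta^(j) = binom(i+j, i) theta^(i+j),
   where theta^(i) x is [theta x i]. *)
Definition iterative (V : zmodType) (theta : V -> {fps V}) : Prop :=
  (forall x, theta x 0 = x) /\
  (forall i j x, theta (theta x j) i = theta x (i + j)%N *+ 'C(i + j, i)).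

Definition is_iterative_derivation (R : comNzRingType)
    (theta : {rmorphism R -> {fps R}}) : Prop :=
  iterative theta.

Definition is_ID_ideal (R : comNzRingType) (theta : {rmorphism R -> {fps R}})
    (I : set R) : Prop :=
  is_ideal I /\ theta @` I `<=` fps_set I.

(* The ring is nonzero by the choice of [comNzRingType]. *)
Definition ID_simple (R : comNzRingType) (theta : {rmorphism R -> {fps R}}) :
    Prop :=
  forall I : set R, is_ID_ideal theta I -> I = [set 0] \/ I = [set: R].

Definition is_ID_module (R : comNzRingType) (theta : {rmorphism R -> {fps R}})
    (M : lmodType R) (thetaM : {additive M -> {fps M}}) : Prop :=
  [/\ finitely_generated [set: M],
      forall (r : R) (m : M), thetaM (r *: m) = theta r *: thetaM m
    & iterative thetaM].

Definition ID_stable (R : comNzRingType) (M : lmodType R)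
    (thetaM : {additive M -> {fps M}}) (N : set M) : Prop :=
  forall n, (thetaM^~ n) @` N `<=` N.

Definition is_ID_submodule (R : comNzRingType) (M : lmodType R)
    (thetaM : {additive M -> {fps M}}) (N : set M) : Prop :=
  [/\ ID_stable thetaM N, is_submodule N & finitely_generated N].

(* Main.v *)
Require Import Defs.
From HB Require Import structures.
From mathcomp Require Import all_boot all_order all_algebra.
From mathcomp Require Import perm boolp classical_sets.
Set Implicit Arguments.
Unset Strict Implicit.
Unset Printing Implicit Defensive.
Import GRing.Theory.
Local Open Scope ring_scope.
Local Open Scope classical_set_scope.

(** Let m_1, ..., m_n generate M and let K, in S^n, be the module of all rows a
    with a_1 m_1 + ... + a_n m_n in N: it presents M / N, it maps onto N, and it
    is enough to show that K is finitely generated. Let I_r be the ideal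
    generated by the r x r minors of the matrices with rows in K (the Fitting
    ideals of M / N, in another numbering).

    Each I_r is an ID-ideal ([minor_ideal_stable]). Writing theta_M(m_i) in terms
    of the m_j gives a matrix B over S[[T]] with B(0) = 1, and since N is
    ID-stable, theta(a) B has all its coefficients in K when a is in K
    ([ID_stable_connection]). So for a matrix A with rows in K the minors of
    theta(A) = (theta(A) B) B^-1 are combinations of minors of theta(A) B, whose
    coefficients are combinations of minors with rows in K.

    As S is ID-simple, each I_r is 0 or S. Now I_0 = S because an empty
    determinant is 1, and I_(n+1) = 0 because a minor of order n+1 repeats a
    column; hence there is r with I_r = S and I_(r+1) = 0. If d is an r x r minor
    of A and a is in K, then expanding the vanishing (r+1)-minors of A bordered
    by a writes d a as a combination of the rows of A ([minor_mul_row]). As 1 is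
    a combination of finitely many such d, the rows of the corresponding
    matrices A generate K ([finite_span_of_minors]). *)

(** * Submodules and ideals as sets *)

Section Submodules.
Variables (R : pzRingType) (M : lmodType R).

Lemma is_submoduleP (N : set M) :
  is_submodule N <-> N 0 /\
    (forall (a : R) (u v : M), N u -> N v -> N (a *: u + v)).
Proof.
split=> [[N0 Nl]|[N0 Nl]].
  split=> [|a u v Nu Nv]; first exact: set_mem.
  by apply: set_mem; apply: Nl; apply: mem_set.
split=> [|a u v /set_mem Nu /set_mem Nv]; first exact: mem_set.
by apply: mem_set; apply: Nl.
Qed.

Variable N : set M.
Hypothesis subN : is_submodule N.

Lemma submodule0 : N 0.
Proof. by have [] := (is_submoduleP N).1 subN. Qed.

Lemma submoduleD u v : N u -> N v -> N (u + v).
Proof.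
by move=> Nu Nv; rewrite -[u]scale1r; apply: ((is_submoduleP N).1 subN).2.
Qed.

Lemma submoduleZ a u : N u -> N (a *: u).
Proof.
move=> Nu; rewrite -[X in N X]addr0.
by apply: ((is_submoduleP N).1 subN).2 => //; exact: submodule0.
Qed.

Lemma submodule_sum (I : finType) (F : I -> M) :
  (forall i, N (F i)) -> N (\sum_i F i).
Proof.
move=> NF; elim/big_ind: _ => //; first exact: submodule0.
exact: submoduleD.
Qed.

Lemma finitely_generated_fintype (I : finType) (g : I -> M) :
  (forall i, N (g i)) ->
  (forall x, N x -> exists c : I -> R, x = \sum_i c i *: g i) ->
  finitely_generated N.
Proof.
move=> Ng genN; exists #|I|, (g \o enum_val); apply/seteqP; split=> x.
  move=> /genN[c ->]; exists (c \o enum_val) => /=.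
  by rewrite (reindex _ (onW_bij _ (@enum_val_bij I))) /=.
by move=> [c ->]; apply: submodule_sum => i; apply: submoduleZ; exact: Ng.
Qed.
End Submodules.

Section Ideals.
Variables (R : comNzRingType) (I : set R).
Hypothesis idI : is_ideal I.

Lemma idealD x y : I x -> I y -> I (x + y).
Proof. exact: (@submoduleD _ _ _ idI). Qed.

Lemma idealMl a x : I x -> I (a * x).
Proof. exact: (@submoduleZ _ _ _ idI a). Qed.

Lemma idealN x : I x -> I (- x).
Proof. by move=> Ix; rewrite -mulN1r; exact: idealMl. Qed.

Lemma ideal_sum (J : finType) (F : J -> R) :
  (forall j, I (F j)) -> I (\sum_j F j).
Proof. exact: (@submodule_sum _ _ _ idI). Qed.
End Ideals.

(** * Power series with coefficients in an ideal *)

Section FpsCoefficients.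
Variable R : comNzRingType.

Lemma fps_sumE (V : zmodType) (J : finType) (F : J -> {fps V}) n :
  (\sum_j F j) n = \sum_j F j n.
Proof. by elim/big_ind2: _ => // f ? g ? <- <-. Qed.

Definition fps_const (c : R) : {fps R} := fun n => if n is 0 then c else 0.

Fact fps_const_is_zmod_morphism : zmod_morphism fps_const.
Proof.
by move=> a b; apply/fpsP => -[|n]; rewrite fpsDE fpsNE //= subr0.
Qed.

Lemma fps_const_mulE c (f : {fps R}) n : (fps_const c * f) n = c * f n.
Proof.
rewrite fpsME big_ord_recl subn0 big1 ?addr0 // => i _.
by rewrite mul0r.
Qed.

Fact fps_const_is_monoid_morphism : monoid_morphism fps_const.
Proof.
split=> [|a b]; apply/fpsP => [[|n]] //; rewrite fps_const_mulE //=.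
by rewrite mulr0.
Qed.

HB.instance Definition _ :=
  GRing.isZmodMorphism.Build R {fps R} fps_const fps_const_is_zmod_morphism.
HB.instance Definition _ :=
  GRing.isMonoidMorphism.Build R {fps R} fps_const fps_const_is_monoid_morphism.

Definition fps_coef0 (f : {fps R}) : R := f 0.

Fact fps_coef0_is_zmod_morphism : zmod_morphism fps_coef0.
Proof. by []. Qed.

Fact fps_coef0_is_monoid_morphism : monoid_morphism fps_coef0.
Proof. by split=> // f g; rewrite /fps_coef0 fpsME big_ord1. Qed.

HB.instance Definition _ :=
  GRing.isZmodMorphism.Build {fps R} R fps_coef0 fps_coef0_is_zmod_morphism.
HB.instance Definition _ :=
  GRing.isMonoidMorphism.Build {fps R} R fps_coef0 fps_coef0_is_monoid_morphism.

Variable I : set R.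
Hypothesis idI : is_ideal I.

Lemma fps_set_ideal : is_ideal (fps_set I).
Proof.
apply/is_submoduleP; split=> [n|f u v Iu Iv n]; first exact: (submodule0 idI).
apply: (idealD idI) => //; apply: (ideal_sum idI) => i.
exact: (idealMl idI).
Qed.

(** A series with constant term 1 is invertible; induction on the degree of
    the coefficient replaces the construction of the inverse. *)
Lemma fps_set_cancel (u f : {fps R}) :
  u 0 = 1 -> fps_set I (u * f) -> fps_set I f.
Proof.
move=> u0 Iuf n; elim/ltn_ind: n => n IHn.
have := Iuf n; rewrite fpsME big_ord_recl subn0 u0 mul1r => Isum.
rewrite -[f n](addrK (\sum_(i < n) u (lift ord0 i) * f (n - lift ord0 i)%N)).
apply: (idealD idI) => //; apply: (idealN idI); apply: (ideal_sum idI) => i.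
apply: (idealMl idI); apply: IHn; rewrite lift0.
by rewrite -subSn // subSS leq_subr.
Qed.

(** By multilinearity in the rows: each coefficient of [\det C] is a sum of
    determinants in which every row of C is replaced by one of its own
    coefficients. The exponent [g i] depends on the row only, so that a condition
    satisfied by all the coefficients of the rows of C passes to the rows of
    the selected matrix. *)
Lemma det_fps_set r (C : 'M[{fps R}]_r) :
  (forall g : 'I_r -> nat, I (\det (\matrix_(i, j) C i j (g i)))) ->
  fps_set I (\det C).
Proof.
move=> Ig.
(* D k g interpolates between C and a constant matrix; an induction on k frees
   the rows one at a time. *)
pose D k (g : 'I_r -> nat) : 'M[{fps R}]_r :=
  \matrix_(i, j) if (i < k)%N then C i j else fps_const (C i j (g i)).
suff ID k g : (k <= r)%N -> fps_set I (\det (D k g)).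
  have -> : C = D r (fun=> 0) by apply/matrixP => i j; rewrite mxE ltn_ord.
  exact: ID.
elim: k g => [|k IHk] g kr.
  have -> : D 0 g = map_mx fps_const (\matrix_(i, j) C i j (g i)).
    by apply/matrixP => i j; rewrite !mxE.
  rewrite det_map_mx => -[|n] //=; exact: (submodule0 idI).
pose i0 := Ordinal kr.
(* Along row i0 the expansions for D k.+1 and D k have the same cofactors, and
   the s-th term of a Cauchy product only sees the coefficient of T^s. *)
pose g' s i := if i == i0 then s else g i.
have cofD s j : cofactor (D k (g' s)) i0 j = cofactor (D k.+1 g) i0 j.
  congr (_ * \det _); apply/matrixP => i l; rewrite !mxE.
  have ni : lift i0 i != i0 by rewrite eq_sym neq_lift.
  have nk : (lift i0 i == k :> nat) = false.
    by apply: contraNF ni => /eqP nk; apply/eqP/val_inj.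
  by rewrite ltnS [in RHS]leq_eqVlt nk /g' (negbTE ni).
move=> n.
have -> : \det (D k.+1 g) n =
    \sum_(s < n.+1) \det (D k (g' s)) (n - s)%N.
  rewrite (expand_det_row _ i0) fps_sumE.
  under eq_bigr do rewrite fpsME.
  rewrite exchange_big; apply: eq_bigr => s _.
  rewrite (expand_det_row _ i0) fps_sumE; apply: eq_bigr => j _.
  by rewrite cofD !mxE /= ltnS leqnn ltnn fps_const_mulE /g' eqxx.
apply: (ideal_sum idI) => s; apply: IHk; exact: ltnW.
Qed.
End FpsCoefficients.

(** * Minors of matrices with rows in a given set *)

(** The Cauchy-Binet expansion before grouping: f runs over all column choices,
    possibly repeated or unordered, which spares any discussion of increasing
    sequences. *)
Lemma det_mulmx_colsub (R : comNzRingType) r n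
    (A : 'M[R]_(r, n)) (B : 'M[R]_(n, r)) :
  \det (A *m B) =
  \sum_(f : {ffun 'I_r -> 'I_n}) (\prod_j B (f j) j) * \det (colsub f A).
Proof.
rewrite -det_tr /determinant.
transitivity (\sum_(s : 'S_r) \sum_(f : {ffun 'I_r -> 'I_n})
    (-1) ^+ s * \prod_j (A (s j) (f j) * B (f j) j)).
  apply: eq_bigr => s _; rewrite -mulr_sumr.
  rewrite -(bigA_distr_bigA (fun j l => A (s j) l * B l j)); congr (_ * _).
  by apply: eq_bigr => j _; rewrite !mxE.
rewrite exchange_big; apply: eq_bigr => f _.
rewrite -/(determinant _) -det_tr mulr_sumr; apply: eq_bigr => s _.
rewrite mulrCA -big_split /=; congr (_ * _); apply: eq_bigr => j _.
by rewrite !mxE mulrC.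
Qed.

Section MinorIdeals.
Variables (R : comNzRingType) (n : nat) (K : set 'rV[R]_n).

Definition is_minor (r : nat) (x : R) : Prop :=
  exists (A : 'M[R]_(r, n)) (f : 'I_r -> 'I_n),
    (forall i, K (row i A)) /\ x = \det (colsub f A).

(** The ideal generated by the minors is encoded as an intersection of ideals, so
    that a property holding on an ideal is checked on minors only. *)
Definition minor_ideal (r : nat) : set R :=
  [set x | forall J : set R, is_ideal J -> is_minor r `<=` J -> J x].

Lemma minor_ideal_ideal r : is_ideal (minor_ideal r).
Proof.
apply/is_submoduleP; split=> [J idJ _|a u v Iu Iv J idJ minJ].
  exact: (submodule0 idJ).
apply: (idealD idJ); last exact: Iv.
by apply: (idealMl idJ); exact: Iu.
Qed.

Lemma sub_minor_ideal r : is_minor r `<=` minor_ideal r.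
Proof. by move=> x minx J _; apply. Qed.

Lemma minor_ideal0 : minor_ideal 0 1.
Proof.
apply: sub_minor_ideal; exists 0, (widen_ord (leq0n n)).
by split=> [[]//|]; rewrite det_mx00.
Qed.

Lemma minor_ideal_large r : (n < r)%N -> minor_ideal r `<=` [set 0].
Proof.
move=> ltnr x; apply.
  apply/is_submoduleP; split=> //= a u v -> ->.
  by rewrite scaler0 addr0.
move=> _ [A [f [_ ->]]] /=.
have /injectivePn[j1 [j2 nj fj]] : ~~ injectiveb f.
  apply/injectiveP => /leq_card; rewrite !card_ord leqNgt.
  by rewrite ltnr.
rewrite -det_tr; apply: (determinant_alternate nj) => i.
by rewrite !mxE fj.
Qed.

Lemma ideal_det_mulmx r (C : 'M[{fps R}]_(r, n)) (Q : 'M[{fps R}]_(n, r)) :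
  (forall i s, K (\row_j C i j s)) ->
  fps_set (minor_ideal r) (\det (C *m Q)).
Proof.
move=> KC; have idI := minor_ideal_ideal r; have idF := fps_set_ideal idI.
rewrite det_mulmx_colsub; apply: (ideal_sum idF) => f.
apply: (idealMl idF); apply: (det_fps_set idI) => g.
apply: sub_minor_ideal; exists (\matrix_(i, j) C i j (g i)), f; split=> [i|].
  by have := KC i (g i); congr K; apply/rowP => j; rewrite !mxE.
by congr (\det _); apply/matrixP => i j; rewrite !mxE.
Qed.

(** The transition matrix B is invertible as B(0) = 1. Multiplying by a power of
    det B and using the adjugate plays the part of multiplying by B^-1. *)
Lemma minor_ideal_stable (theta : {rmorphism R -> {fps R}})
    (B : 'M[{fps R}]_n) r :
  (forall i j, B i j 0 = (i == j)%:R) ->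
  (forall a, K a -> forall s, K (\row_j (map_mx theta a *m B) 0 j s)) ->
  theta @` minor_ideal r `<=` fps_set (minor_ideal r).
Proof.
move=> B0 KB _ [x Ix <-].
have idI := minor_ideal_ideal r; have idF := fps_set_ideal idI.
apply: (Ix (theta @^-1` fps_set (minor_ideal r))).
  apply/is_submoduleP; split=> [|a u v Iu Iv] /=.
    by rewrite rmorph0; exact: (submodule0 idF).
  rewrite rmorphD rmorphM; apply: (idealD idF) => //; exact: (idealMl idF).
move=> _ [A [f [KA ->]]] /=; rewrite -det_map_mx.
apply: (fps_set_cancel idI (u := \det B ^+ r)).
  rewrite -[LHS]/(fps_coef0 _) rmorphXn -det_map_mx /=.
  suff -> : map_mx (@fps_coef0 R) B = 1%:M by rewrite det1 expr1n.
  by apply/matrixP => i j; rewrite !mxE /fps_coef0 B0.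
have -> : \det B ^+ r * \det (map_mx theta (colsub f A)) =
    \det ((map_mx theta A *m B) *m colsub f (\adj B)).
  rewrite -detZ; congr (\det _).
  rewrite mulmx_colsub -mulmxA mul_mx_adj.
  rewrite mul_mx_scalar.
  by apply/matrixP => i j; rewrite !mxE.
apply: ideal_det_mulmx => i s; have := KB _ (KA i) s; congr K.
apply/rowP => j; rewrite !mxE; congr (_ s).
by apply: eq_bigr => l _; rewrite !mxE.
Qed.

(** Cramer's rule: border A by the row a and by its column l. The bordered
    determinant is a minor of order r + 1, so it vanishes, and its expansion
    along the new column has cofactors that do not depend on l. *)
Lemma minor_mul_row r (A : 'M[R]_(r, n)) (f : 'I_r -> 'I_n) (a : 'rV[R]_n) :
  (forall i, K (row i A)) -> K a -> minor_ideal r.+1 `<=` [set 0] ->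
  exists c : 'I_r -> R, \det (colsub f A) *: a = \sum_i c i *: row i A.
Proof.
move=> KA Ka I0.
pose A' : 'M[R]_(r.+1, n) :=
  \matrix_(i, j) if unlift ord0 i is Some k then A k j else a 0 j.
pose f' l (j : 'I_r.+1) := if unlift ord0 j is Some k then f k else l.
pose cof l i := cofactor (colsub (f' l) A') i ord0.
have cofE l l' i : cof l i = cof l' i.
  congr (_ * \det _); apply/matrixP => k j; rewrite !mxE /f'.
  by rewrite liftK.
have det0 l : \det (colsub (f' l) A') = 0.
  apply: I0; apply: sub_minor_ideal; exists A', (f' l); split=> // i.
  case: (unliftP ord0 i) => [k|] ->.
    have -> : row (lift ord0 k) A' = row k A; last exact: KA.
    by apply/rowP => j; rewrite !mxE liftK.
  have -> : row ord0 A' = a; last exact: Ka.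
  by apply/rowP => j; rewrite !mxE unlift_none.
case: (posnP n) => [n0|n_gt0].
  by exists (fun=> 0); apply/rowP => j; have := ltn_ord j; rewrite {2}n0.
(* Any column serves to name the cofactors, which are the same for all. *)
pose l0 := Ordinal n_gt0.
exists (fun i => - cof l0 (lift ord0 i)); apply/rowP => l.
have := det0 l; rewrite (expand_det_col _ ord0) big_ord_recl.
have cof0 : cof l ord0 = \det (colsub f A).
  rewrite /cof /cofactor expr0 mul1r; congr (\det _); apply/matrixP => i j.
  by rewrite !mxE /f' !liftK.
rewrite -/(cof l _) cof0 !mxE /f' !unlift_none mulrC => /eqP.
rewrite addr_eq0 => /eqP ->.
rewrite summxE -sumrN; apply: eq_bigr => i _.
by rewrite !mxE unlift_none liftK -/(cof l _) (cofE l l0) mulNr mulrC.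
Qed.

Lemma finite_span_of_minors r :
  minor_ideal r 1 -> minor_ideal r.+1 `<=` [set 0] ->
  exists (I : finType) (g : I -> 'rV[R]_n), (forall i, K (g i)) /\
    forall a, K a -> exists c : I -> R, a = \sum_i c i *: g i.
Proof.
move=> I1 I0.
(* The multipliers sending K into the span of a finite part of K form an ideal,
   because finite parts can be united; it contains the minors of order r. *)
pose J : set R := [set d | exists (I : finType) (g : I -> 'rV[R]_n),
  (forall i, K (g i)) /\
  forall a, K a -> exists c : I -> R, d *: a = \sum_i c i *: g i].
suff [I [g [Kg genK]]] : J 1.
  by exists I, g; split=> // a /genK[c]; rewrite scale1r => ->; exists c.
apply: I1.
  apply/is_submoduleP; split.
    exists void, (of_void _); split=> [[]|a _]; exists (fun=> 0).
    by rewrite scale0r big1 // => -[].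
  move=> b u v [I [g [Kg gen]]] [I' [g' [Kg' gen']]].
  exists (I + I')%type,
    (fun t => match t with inl i => g i | inr i => g' i end).
  split=> [[]//|a Ka].
  have [c cE] := gen a Ka; have [c' cE'] := gen' a Ka.
  exists (fun t => match t with inl i => b * c i | inr i => c' i end).
  rewrite big_sumType /= -cE' scalerDl; congr (_ + _).
  rewrite -scalerA cE scaler_sumr.
  by apply: eq_bigr => i _; rewrite scalerA.
move=> _ [A [f [KA ->]]]; exists 'I_r, (fun i => row i A); split=> // a Ka.
exact: minor_mul_row.
Qed.
End MinorIdeals.

(** * ID-stable submodules over an ID-simple ring *)

(** B is the matrix of theta_M on the generators m. They need not be free, so B
    involves a choice; at T = 0 the identity is a legitimate one. *)
Lemma ID_stable_connection (S : comNzRingType)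
    (theta : {rmorphism S -> {fps S}})
    (M : lmodType S) (thetaM : {additive M -> {fps M}}) n (m : 'I_n -> M)
    (N : set M) :
  (forall x : M, exists c : 'I_n -> S, x = \sum_i c i *: m i) ->
  (forall (r : S) (x : M), thetaM (r *: x) = theta r *: thetaM x) ->
  (forall x, thetaM x 0 = x) -> ID_stable thetaM N ->
  exists B : 'M[{fps S}]_n, (forall i j, B i j 0 = (i == j)%:R) /\
    forall a : 'rV[S]_n, N (\sum_j a 0 j *: m j) ->
    forall s, N (\sum_j (map_mx theta a *m B) 0 j s *: m j).
Proof.
move=> gen thetaZ theta0 stN.
have /boolp.choice[b bE] : forall t : nat * 'I_n, exists c : 'I_n -> S,
    thetaM (m t.2) t.1 = \sum_j c j *: m j.
  by move=> t; exact: gen.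
pose B : 'M[{fps S}]_n :=
  \matrix_(i, j) fun s => if s is 0 then (i == j)%:R else b (s, i) j.
have BE i s : thetaM (m i) s = \sum_j B i j s *: m j.
  case: s => [|s].
    rewrite theta0 (bigD1 i) //= mxE eqxx scale1r big1 ?addr0 // => j ji.
    by rewrite mxE eq_sym (negbTE ji) scale0r.
  by rewrite (bE (s.+1, i)); apply: eq_bigr => j _; rewrite mxE.
exists B; split=> [i j|a Na s]; first by rewrite mxE.
suff -> : \sum_j (map_mx theta a *m B) 0 j s *: m j =
    thetaM (\sum_j a 0 j *: m j) s by apply: stN; exists (\sum_j a 0 j *: m j).
rewrite raddf_sum fps_sumE.
under [RHS]eq_bigr do rewrite thetaZ fpsZE.
under [LHS]eq_bigr do rewrite mxE fps_sumE scaler_suml.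
rewrite exchange_big; apply: eq_bigr => l _.
under [LHS]eq_bigr do rewrite fpsME scaler_suml.
rewrite exchange_big; apply: eq_bigr => i _.
rewrite BE scaler_sumr; apply: eq_bigr => j _.
by rewrite scalerA mxE.
Qed.

Theorem corollary4p4 (S : comNzRingType) (theta : {rmorphism S -> {fps S}})
    (M : lmodType S) (thetaM : {additive M -> {fps M}}) :
  is_iterative_derivation theta -> ID_simple theta ->
  is_ID_module theta thetaM ->
  forall N : set M, is_submodule N -> ID_stable thetaM N ->
    finitely_generated N /\ is_ID_submodule thetaM N.
Proof.
move=> _ simpleS [[n [m mE]] thetaZ [theta0 _]] N subN stN.
have gen x : exists c : 'I_n -> S, x = \sum_i c i *: m i.
  by have : [set: M] x by []; rewrite mE.
suff fgN : finitely_generated N by split.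
have [B [B0 NB]] := ID_stable_connection gen thetaZ theta0 stN.
pose K : set 'rV[S]_n := [set a | N (\sum_j a 0 j *: m j)].
have minor_simple r : minor_ideal K r = [set 0] \/ minor_ideal K r = [set: S].
  apply: simpleS; split; first exact: minor_ideal_ideal.
  apply: (minor_ideal_stable B0) => a Ka s.
  have := NB a Ka s; congr N; apply: eq_bigr => j _.
  by rewrite [in RHS]mxE.
have [r [I1 I0]] : exists r,
    minor_ideal K r 1 /\ minor_ideal K r.+1 `<=` [set 0].
  apply: contrapT => no_jump.
  suff I1 k : minor_ideal K k 1.
    by have /eqP := minor_ideal_large (ltnSn n) (I1 n.+1); rewrite oner_eq0.
  elim: k => [|k IHk]; first exact: minor_ideal0.
  have [I0|->] := minor_simple k.+1; last exact: Logic.I.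
  by case: no_jump; exists k; split=> //; rewrite I0.
have [I [g [Kg genK]]] := finite_span_of_minors I1 I0.
pose h i := \sum_j g i 0 j *: m j.
apply: (finitely_generated_fintype subN (g := h)) => // x Nx.
have [a aE] := gen x.
have /genK[c cE] : K (\row_j a j).
  by rewrite /K /= (eq_bigr (fun j => a j *: m j)) -?aE // => j _; rewrite mxE.
exists c; rewrite aE.
under [RHS]eq_bigr do rewrite scaler_sumr.
rewrite exchange_big; apply: eq_bigr => j _.
have /rowP/(_ j) := cE; rewrite mxE => ->.
rewrite summxE scaler_suml; apply: eq_bigr => i _.
by rewrite mxE scalerA.
Qed.
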